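(* (1) Let $\mathbb C$ be an efficiently regular category and $f:X\twoheadrightarrow Y$ a regular epimorphism in $\mathbb C$, with kernel equivalence relation $p_0,p_1:R[f]\rightrightarrows X$. If the map $p_0$ is algebraically exponentiable, then $f$ is itself algebraically exponentiable and there is a natural isomorphism $f^*\circ\Phi_f\simeq \Phi_{p_0}\circ p_1^*$ of endofunctors of $Pt_X\mathbb C$. (2) When $\mathbb C$ is efficiently regular and fiberwise algebraically cartesian closed, any regular epimorphism $f:X\twoheadrightarrow Y$ in $\mathbb C$ is algebraically exponentiable.
   Context: For a finitely complete category $\mathbb C$ and an object $Y$, $Pt_Y\mathbb C$ has as objects the pairs $(f:X\to Y,\ s:Y\to X)$ with $fs=1_Y$, and as morphisms the maps over $Y$ commuting with the sections. For $h:X\to Y$, $h^*:Pt_Y\mathbb C\to Pt_X\mathbb C$ is the change of base functor given by pulling back along $h$. A morphism $h$ is algebraically exponentiable when $h^*$ admits a right adjoint, denoted $\Phi_h$. A category $\mathbb D$ with products is algebraically cartesian closed when for every object $Y$ with terminal map $\tau_Y:Y\to 1$ the functor $\tau_Y^*:Pt_1\mathbb D\to Pt_Y\mathbb D$ has a right adjoint. $\mathbb C$ is fiberwise algebraically cartesian closed when every fibre $Pt_Y\mathbb C$ is algebraically cartesian closed; equivalently, when every split epimorphism in $\mathbb C$ is algebraically exponentiable. A regular category $\mathbb C$ is efficiently regular when any equivalence relation $S$ on an object $X$ which is included in an effective equivalence relation $R[f]$ (the kernel pair of a map $f$) by an effective monomorphism $m:S\rightarrowtail R[f]$ (i.e.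 an equalizer) is itself effective. *)

(* Defs.v *)
From Stdlib Require Import ProofIrrelevance.
From Corelib Require Import ssreflect.

Set Implicit Arguments.
Unset Strict Implicit.
Unset Printing Implicit Defensive.

Declare Scope cat_scope.
Open Scope cat_scope.

(** * Categories, functors, adjunctions *)

Record category := Category {
  obj :> Type;
  hom : obj -> obj -> Type;
  idm : forall X, hom X X;
  comp : forall X Y Z, hom Y Z -> hom X Y -> hom X Z;
  comp_idl : forall X Y (f : hom X Y), comp (idm Y) f = f;
  comp_idr : forall X Y (f : hom X Y), comp f (idm X) = f;
  comp_assoc : forall X Y Z W (h : hom Z W) (g : hom Y Z) (f : hom X Y),
    comp h (comp g f) = comp (comp h g) f
}.
Arguments hom {c} X Y.
Arguments idm {c} X.
Arguments comp {c X Y Z} g f.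

Notation "g ∘ f" := (comp g f) (at level 40, left associativity) : cat_scope.

Record functor (C D : category) := Functor {
  fobj :> C -> D;
  fmap : forall X Y : C, hom X Y -> hom (fobj X) (fobj Y);
  fmap_id : forall X : C, fmap (idm X) = idm (fobj X);
  fmap_comp : forall (X Y Z : C) (g : hom Y Z) (f : hom X Y),
    fmap (g ∘ f) = fmap g ∘ fmap f
}.
Arguments fmap {C D} _ {X Y} _.

Definition functor_id (C : category) : functor C C.
Proof. by exists (fun X => X) (fun X Y f => f). Defined.

Definition functor_comp (C D E : category) (G : functor D E) (F : functor C D) :
  functor C E.
Proof.
exists (fun X => G (F X)) (fun X Y f => fmap G (fmap F f)).
- by move=> X; rewrite !fmap_id.
- by move=> X Y Z g f; rewrite !fmap_comp.
Defined.

Record nat_trans (C D : category) (F G : functor C D) := NatTrans {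
  nt :> forall X : C, hom (F X) (G X);
  nt_natural : forall (X Y : C) (f : hom X Y), nt Y ∘ fmap F f = fmap G f ∘ nt X
}.

Definition is_iso (C : category) (X Y : C) (f : hom X Y) : Prop :=
  exists g : hom Y X, g ∘ f = idm X /\ f ∘ g = idm Y.

Definition naturally_isomorphic (C D : category) (F G : functor C D) : Prop :=
  exists a : nat_trans F G, forall X : C, is_iso (a X).

Definition is_right_adjoint (C D : category) (F : functor C D) (G : functor D C) :
  Prop :=
  exists (eta : nat_trans (functor_id C) (functor_comp G F))
         (eps : nat_trans (functor_comp F G) (functor_id D)),
    (forall X : C, eps (F X) ∘ fmap F (eta X) = idm (F X)) /\
    (forall Y : D, fmap G (eps Y) ∘ eta (G Y) = idm (G Y)).

Definition has_right_adjoint (C D : category) (F : functor C D) : Prop :=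
  exists G : functor D C, is_right_adjoint F G.

(** * Limits and colimits *)

Definition is_pullback (C : category) (X Y Z P : C) (f : hom X Z) (g : hom Y Z)
    (p : hom P X) (q : hom P Y) : Prop :=
  f ∘ p = g ∘ q /\
  forall (T : C) (a : hom T X) (b : hom T Y), f ∘ a = g ∘ b ->
    exists! u : hom T P, p ∘ u = a /\ q ∘ u = b.

Definition is_equalizer (C : category) (M X Z : C) (u v : hom X Z) (m : hom M X) :
  Prop :=
  u ∘ m = v ∘ m /\
  forall (T : C) (a : hom T X), u ∘ a = v ∘ a -> exists! k : hom T M, m ∘ k = a.

Definition is_coequalizer (C : category) (R X Q : C) (u v : hom R X) (q : hom X Q) :
  Prop :=
  q ∘ u = q ∘ v /\
  forall (T : C) (a : hom X T), a ∘ u = a ∘ v -> exists! k : hom Q T, k ∘ q = a.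

(** Finite completeness is given as a choice of terminal object and pullbacks, so
    that the change of base functors below are determined by the category. *)
Record fc_category := FCCategory {
  fc_cat :> category;
  one : fc_cat;
  to_one : forall X : fc_cat, hom X one;
  to_one_unique : forall (X : fc_cat) (f : hom X one), f = to_one X;
  pb : forall (X Y Z : fc_cat) (f : hom X Z) (g : hom Y Z), fc_cat;
  pb1 : forall (X Y Z : fc_cat) (f : hom X Z) (g : hom Y Z), hom (pb f g) X;
  pb2 : forall (X Y Z : fc_cat) (f : hom X Z) (g : hom Y Z), hom (pb f g) Y;
  pb_comm : forall (X Y Z : fc_cat) (f : hom X Z) (g : hom Y Z),
    f ∘ pb1 f g = g ∘ pb2 f g;
  pb_lift : forall (X Y Z : fc_cat) (f : hom X Z) (g : hom Y Z)
      (T : fc_cat) (a : hom T X) (b : hom T Y), f ∘ a = g ∘ b -> hom T (pb f g);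
  pb1_lift : forall (X Y Z : fc_cat) (f : hom X Z) (g : hom Y Z)
      (T : fc_cat) (a : hom T X) (b : hom T Y) (e : f ∘ a = g ∘ b),
    pb1 f g ∘ pb_lift e = a;
  pb2_lift : forall (X Y Z : fc_cat) (f : hom X Z) (g : hom Y Z)
      (T : fc_cat) (a : hom T X) (b : hom T Y) (e : f ∘ a = g ∘ b),
    pb2 f g ∘ pb_lift e = b;
  pb_ext : forall (X Y Z : fc_cat) (f : hom X Z) (g : hom Y Z)
      (T : fc_cat) (u v : hom T (pb f g)),
    pb1 f g ∘ u = pb1 f g ∘ v -> pb2 f g ∘ u = pb2 f g ∘ v -> u = v
}.
Arguments one {C} : rename.
Arguments to_one {C} X : rename.
Arguments pb {C X Y Z} f g : rename.
Arguments pb1 {C X Y Z} f g : rename.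
Arguments pb2 {C X Y Z} f g : rename.
Arguments pb_lift {C X Y Z f g T a b} e : rename.

Lemma pb_is_pullback (C : fc_category) (X Y Z : C) (f : hom X Z) (g : hom Y Z) :
  is_pullback f g (pb1 f g) (pb2 f g).
Proof.
split; first exact: pb_comm.
move=> T a b e; exists (pb_lift e); split.
  by split; [exact: pb1_lift | exact: pb2_lift].
move=> u [ua ub]; apply: pb_ext.
- by rewrite pb1_lift ua.
- by rewrite pb2_lift ub.
Qed.

(** * Regular and efficiently regular categories *)

Definition regular_epi (C : category) (X Y : C) (f : hom X Y) : Prop :=
  exists (R : C) (u v : hom R X), is_coequalizer u v f.

Definition effective_mono (C : category) (M X : C) (m : hom M X) : Prop :=
  exists (Z : C) (u v : hom X Z), is_equalizer u v m.

Definition is_kernel_pair (C : category) (X Y R : C) (f : hom X Y)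
    (p0 p1 : hom R X) : Prop :=
  is_pullback f f p0 p1.

Definition equivalence_relation (C : fc_category) (X S : C) (d0 d1 : hom S X) :
  Prop :=
  (forall (T : C) (a b : hom T S), d0 ∘ a = d0 ∘ b -> d1 ∘ a = d1 ∘ b -> a = b) /\
  (exists r : hom X S, d0 ∘ r = idm X /\ d1 ∘ r = idm X) /\
  (exists s : hom S S, d0 ∘ s = d1 /\ d1 ∘ s = d0) /\
  (exists t : hom (pb d1 d0) S,
     d0 ∘ t = d0 ∘ pb1 d1 d0 /\ d1 ∘ t = d1 ∘ pb2 d1 d0).

Definition effective (C : category) (X S : C) (d0 d1 : hom S X) : Prop :=
  exists (Y : C) (f : hom X Y), is_kernel_pair f d0 d1.

Definition regular (C : fc_category) : Prop :=
  (forall (X Y R : C) (f : hom X Y) (p0 p1 : hom R X), is_kernel_pair f p0 p1 ->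
     exists (Q : C) (q : hom X Q), is_coequalizer p0 p1 q) /\
  (forall (X Y Z P : C) (f : hom X Z) (g : hom Y Z) (p : hom P X) (q : hom P Y),
     is_pullback f g p q -> regular_epi f -> regular_epi q).

Definition efficiently_regular (C : fc_category) : Prop :=
  regular C /\
  forall (X S : C) (d0 d1 : hom S X), equivalence_relation d0 d1 ->
  forall (Y R : C) (f : hom X Y) (p0 p1 : hom R X), is_kernel_pair f p0 p1 ->
  forall m : hom S R, p0 ∘ m = d0 -> p1 ∘ m = d1 -> effective_mono m ->
  effective d0 d1.

(** * The fibration of points *)

Record point (C : category) (Y : C) := Point {
  pdom : C;
  pmap : hom pdom Y;
  psec : hom Y pdom;
  pmap_sec : pmap ∘ psec = idm Y
}.

Record point_hom (C : category) (Y : C) (A B : point Y) := PointHom {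
  ph :> hom (pdom A) (pdom B);
  ph_map : pmap B ∘ ph = pmap A;
  ph_sec : ph ∘ psec A = psec B
}.

Lemma point_hom_ext (C : category) (Y : C) (A B : point Y) (f g : point_hom A B) :
  ph f = ph g -> f = g.
Proof.
case: f g => [f f1 f2] [g g1 g2] /= e; subst g.
by rewrite (proof_irrelevance _ f1 g1) (proof_irrelevance _ f2 g2).
Qed.

Definition point_id (C : category) (Y : C) (A : point Y) : point_hom A A.
Proof. exists (idm (pdom A)); [exact: comp_idr | exact: comp_idl]. Defined.

Definition point_comp (C : category) (Y : C) (A B D : point Y)
  (g : point_hom B D) (f : point_hom A B) : point_hom A D.
Proof.
exists (ph g ∘ ph f).
- by rewrite comp_assoc !ph_map.
- by rewrite -comp_assoc !ph_sec.
Defined.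

Definition Pt (C : category) (Y : C) : category.
Proof.
apply: (@Category (point Y) (@point_hom C Y) (@point_id C Y) (@point_comp C Y)).
- by move=> A B f; apply: point_hom_ext; exact: comp_idl.
- by move=> A B f; apply: point_hom_ext; exact: comp_idr.
- by move=> A B D E h g f; apply: point_hom_ext; exact: comp_assoc.
Defined.

Section PtFinitelyComplete.
Variables (C : fc_category) (Y : C).

Definition Pt_one : Pt Y.
Proof. exists Y (idm Y) (idm Y); exact: comp_idl. Defined.

Definition Pt_to_one (A : Pt Y) : hom A Pt_one.
Proof. exists (pmap A); [exact: comp_idl | exact: pmap_sec]. Defined.

Lemma Pt_to_one_unique (A : Pt Y) (f : hom A Pt_one) : f = Pt_to_one A.
Proof. by apply: point_hom_ext; rewrite /= -(ph_map f) /= comp_idl. Qed.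

Section Pullback.
Variables (A B D : Pt Y) (f : hom A D) (g : hom B D).

Lemma Pt_pb_sec : ph f ∘ psec A = ph g ∘ psec B.
Proof. by rewrite !ph_sec. Qed.

Definition Pt_pb : Pt Y.
Proof.
exists (pb (ph f) (ph g)) (pmap A ∘ pb1 (ph f) (ph g)) (pb_lift Pt_pb_sec).
by rewrite -comp_assoc pb1_lift pmap_sec.
Defined.

Definition Pt_pb1 : hom Pt_pb A.
Proof. exists (pb1 (ph f) (ph g)); [by [] | exact: pb1_lift]. Defined.

Definition Pt_pb2 : hom Pt_pb B.
Proof.
exists (pb2 (ph f) (ph g)); last exact: pb2_lift.
by rewrite /= -(ph_map f) -(ph_map g) -!comp_assoc pb_comm.
Defined.

Lemma Pt_pb_comm : f ∘ Pt_pb1 = g ∘ Pt_pb2.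
Proof. by apply: point_hom_ext; exact: pb_comm. Qed.

Definition Pt_pb_lift (T : Pt Y) (a : hom T A) (b : hom T B) (e : f ∘ a = g ∘ b) :
  hom T Pt_pb.
Proof.
exists (pb_lift (f_equal (@ph _ _ _ _) e : ph f ∘ ph a = ph g ∘ ph b)).
- by rewrite /= -comp_assoc pb1_lift ph_map.
- apply: pb_ext.
  + by rewrite comp_assoc !pb1_lift ph_sec.
  + by rewrite comp_assoc !pb2_lift ph_sec.
Defined.

End Pullback.

Definition Pt_fc : fc_category.
Proof.
apply: (@FCCategory (Pt Y) Pt_one Pt_to_one Pt_to_one_unique
          Pt_pb Pt_pb1 Pt_pb2 Pt_pb_comm Pt_pb_lift).
- by move=> A B D f g T a b e; apply: point_hom_ext; exact: pb1_lift.
- by move=> A B D f g T a b e; apply: point_hom_ext; exact: pb2_lift.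
- move=> A B D f g T u v e1 e2; apply: point_hom_ext; apply: pb_ext.
  + exact: (f_equal (@ph _ _ _ _) e1).
  + exact: (f_equal (@ph _ _ _ _) e2).
Defined.

End PtFinitelyComplete.

Section ChangeOfBase.
Variables (C : fc_category) (X Y : C) (h : hom X Y).

Lemma base_point_sec (A : Pt Y) : h ∘ idm X = pmap A ∘ (psec A ∘ h).
Proof. by rewrite comp_assoc pmap_sec comp_idl comp_idr. Qed.

Definition base_point (A : Pt Y) : Pt X.
Proof.
exists (pb h (pmap A)) (pb1 h (pmap A)) (pb_lift (base_point_sec A)).
exact: pb1_lift.
Defined.

Lemma base_hom_comm (A B : Pt Y) (k : hom A B) :
  h ∘ pb1 h (pmap A) = pmap B ∘ (ph k ∘ pb2 h (pmap A)).
Proof. by rewrite comp_assoc ph_map pb_comm. Qed.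

Definition base_hom (A B : Pt Y) (k : hom A B) : hom (base_point A) (base_point B).
Proof.
exists (pb_lift (base_hom_comm k)); first exact: pb1_lift.
apply: pb_ext; rewrite comp_assoc.
- by rewrite !pb1_lift.
- by rewrite !pb2_lift -comp_assoc pb2_lift comp_assoc ph_sec.
Defined.

Definition change_of_base : functor (Pt Y) (Pt X).
Proof.
exists base_point base_hom.
- move=> A; apply: point_hom_ext; apply: pb_ext; rewrite /=.
  + by rewrite pb1_lift comp_idr.
  + by rewrite pb2_lift comp_idl comp_idr.
- move=> A B D g f; apply: point_hom_ext; apply: pb_ext; rewrite /= comp_assoc.
  + by rewrite !pb1_lift.
  + by rewrite !pb2_lift /= -!comp_assoc pb2_lift.
Defined.

End ChangeOfBase.

Definition algebraically_exponentiable (C : fc_category) (X Y : C) (h : hom X Y) :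
  Prop :=
  has_right_adjoint (change_of_base h).

Definition algebraically_cartesian_closed (D : fc_category) : Prop :=
  forall Y : D, has_right_adjoint (change_of_base (to_one Y)).

Definition fiberwise_algebraically_cartesian_closed (C : fc_category) : Prop :=
  forall Y : C, algebraically_cartesian_closed (Pt_fc Y).

(* Main.v *)
From Stdlib Require Import ProofIrrelevance IndefiniteDescription.
From Corelib Require Import ssreflect.
Require Import Defs.

Set Implicit Arguments.
Unset Strict Implicit.
Unset Printing Implicit Defensive.

(** Generalized elements are used throughout: a map Z -> P is an element of P at
    stage Z, and the elements of a pullback are written as pairs. When f is fixed,
    x ~ y abbreviates f x = f y for elements x, y of X; a point T over X is thought
    of as a family of pointed objects T_x, with zero element 0_x given by the
    section.

    Suppose that f^* had a right adjoint satisfying f^* Phi_f = Phi_p0 p1^*. Then,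
    for a point A over X, the fibre over x of B := Phi_p0 (p1^* A) would consist
    of the compatible families (a_y in A_y), y ~ x. Such a family does not refer
    to x, so B ought to carry descent data along f, and the point of which it is the
    pullback ought to be Phi_f A. This is what is proved.

    - Evaluation. The counit of p0^* -| Phi_p0 is a map ev sending b in B_x and
      y ~ x to ev(b, y) in A_y, universal among such maps out of points over X
      ([evaluation_universal]).

    - Transport ([transport_action]). For b in B_x and y ~ x there is a unique
      theta(b, y) in B_y evaluating like b. Change of base of points need not have
      a left adjoint, so the Beck-Chevalley argument available for slices does not
      apply; instead the pairs (b, y) with y ~ x are themselves made into a point
      over X, by (b, y) |-> y and y |-> (0_y, y), and the universal property of B
      is applied to it. Every equation about theta (zero, unit, cocycle) follows in
      the same way: both sides are maps of points into B with the same evaluation.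

    - Descent ([descent_quotient]). The pairs (b, theta(b, y)) form an equivalence
      relation on B. It is the equalizer, inside the kernel pair of B -> X -> Y, of
      (b, b') |-> b' and (b, b') |-> theta(b, p b'); this is where efficient
      regularity enters, and the relation is the kernel pair of a quotient
      q : B -> D. As in the Barr-Kock theorem, B is then the pullback of D along f.

    - Adjunction ([descended_couniversal]). A map k : f^* T -> A gives the family
      ((x, t), y) |-> k(y, t), hence a map u : f^* T -> B, its mate; it commutes
      with transport, so it descends to T -> D. Hence D, with ev restricted to the
      diagonal, is couniversal from f^* to A.

    The comparison f^* Phi_f -> Phi_p0 p1^* consists of the mates of the counit of
    Phi_f; it is natural by uniqueness of mates, and invertible since D has an
    invertible mate and couniversal arrows are unique up to isomorphism.

    For the second assertion, p0 : R[f] -> X is split by the diagonal, and change of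
    base along a split epimorphism p : X -> Y is change of base, within the fibre
    Pt_Y, along the terminal map of the object (p, s) ([split_epi_exponentiable]). *)

(** * Adjoints from couniversal arrows *)

Lemma whisker (C : category) (X Y Z : C) (a : hom Y Z) (b : hom X Y) (c : hom X Z) :
  a ∘ b = c -> forall (W : C) (z : hom W X), a ∘ (b ∘ z) = c ∘ z.
Proof. by move=> <- W z; rewrite comp_assoc. Qed.

Definition couniversal (C D : category) (F : functor C D) (A : D) (B : C)
    (e : hom (F B) A) : Prop :=
  forall (T : C) (k : hom (F T) A), exists! u : hom T B, e ∘ fmap F u = k.

Lemma counit_couniversal (C D : category) (F : functor C D) (G : functor D C)
    (eta : nat_trans (functor_id C) (functor_comp G F))
    (eps : nat_trans (functor_comp F G) (functor_id D)) :
  (forall X : C, eps (F X) ∘ fmap F (eta X) = idm (F X)) ->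
  (forall Y : D, fmap G (eps Y) ∘ eta (G Y) = idm (G Y)) ->
  forall A : D, couniversal (eps A : hom (F (G A)) A).
Proof.
move=> tri1 tri2 A T k; exists (fmap G k ∘ eta T); split.
- rewrite fmap_comp comp_assoc (nt_natural eps k) /=.
  by rewrite -comp_assoc tri1 comp_idr.
- move=> u <-; rewrite fmap_comp -comp_assoc -(nt_natural eta u) /=.
  by rewrite comp_assoc tri2 comp_idl.
Qed.

(** Couniversal arrows, known to exist one object at a time, are assembled into a
    functor by choosing one for each object. *)
Lemma couniversal_right_adjoint (C D : category) (F : functor C D) :
  (forall A : D, exists (B : C) (e : hom (F B) A), couniversal e) ->
  has_right_adjoint F.
Proof.
move=> ex.
have GE A : {B : C & {e : hom (F B) A | couniversal e}}.
  have [B] := constructive_indefinite_description _ (ex A).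
  by move=> /constructive_indefinite_description e; exists B.
pose G0 A : C := projT1 (GE A); pose e A : hom (F (G0 A)) A := proj1_sig (projT2 (GE A)).
have eE A : couniversal (e A) by exact: proj2_sig (projT2 (GE A)).
pose tr A T (k : hom (F T) A) := proj1_sig (constructive_indefinite_description _ (eE A T k)).
have trE A T (k : hom (F T) A) : e A ∘ fmap F (tr A T k) = k.
  by rewrite /tr; case: constructive_indefinite_description => u [].
have ext A T (u v : hom T (G0 A)) : e A ∘ fmap F u = e A ∘ fmap F v -> u = v.
  move=> uv; have [w [_ wu]] := eE A T (e A ∘ fmap F v).
  by rewrite -(wu u uv) (wu v).
have G1 A : tr _ _ (idm A ∘ e A) = idm (G0 A).
  by apply: ext; rewrite trE fmap_id comp_idl comp_idr.
have GM A B E (g : hom B E) (h : hom A B) :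
    tr _ _ (g ∘ h ∘ e A) = tr _ _ (g ∘ e B) ∘ tr _ _ (h ∘ e A).
  by apply: ext; rewrite trE fmap_comp comp_assoc trE -!comp_assoc trE.
pose G := @Functor D C G0 (fun A B h => tr _ _ (h ∘ e A)) G1 GM.
have etaN T U (h : hom T U) :
    tr _ _ (idm (F U)) ∘ fmap (functor_id C) h
    = fmap (functor_comp G F) h ∘ tr _ _ (idm (F T)).
  apply: ext; rewrite /= !fmap_comp !comp_assoc !trE comp_idl.
  by rewrite -comp_assoc trE comp_idr.
have epsN A B (h : hom A B) :
    e B ∘ fmap (functor_comp F G) h = fmap (functor_id D) h ∘ e A.
  by rewrite /= trE.
exists G, (NatTrans (F := functor_id C) (G := functor_comp G F) etaN).
exists (NatTrans (F := functor_comp F G) (G := functor_id D) epsN); split => /=.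
- by move=> T; exact: trE.
- by move=> A; apply: ext; rewrite fmap_comp comp_assoc trE -comp_assoc trE fmap_id.
Qed.

(** * Regular epimorphisms and pullbacks *)

Lemma coequalizer_epi (C : category) (R X Q : C) (u v : hom R X) (q : hom X Q) :
  is_coequalizer u v q ->
  forall (T : C) (a b : hom Q T), a ∘ q = b ∘ q -> a = b.
Proof.
move=> [quv qU] T a b ab.
have [|k [_ kU]] := qU T (b ∘ q); first by rewrite -!comp_assoc quv.
by rewrite -(kU a ab) (kU b).
Qed.

Lemma regular_epi_epi (C : category) (X Q : C) (q : hom X Q) : regular_epi q ->
  forall (T : C) (a b : hom Q T), a ∘ q = b ∘ q -> a = b.
Proof. by move=> [R [u [v co]]]; exact: coequalizer_epi co. Qed.

Lemma regular_epi_factor (C : category) (X Q T : C) (q : hom X Q) (a : hom X T) :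
  regular_epi q ->
  (forall (Z : C) (u v : hom Z X), q ∘ u = q ∘ v -> a ∘ u = a ∘ v) ->
  exists b : hom Q T, b ∘ q = a.
Proof.
move=> [R [u [v [quv qU]]]] aE.
by have [b [bq _]] := qU T a (aE _ _ _ quv); exists b.
Qed.

(** Since c is a monomorphism, k identifies whatever the regular epimorphism c k does;
    so k factors through c k, and the factor is a section of c. *)
Lemma mono_strong_iso (C : category) (X M Q : C) (c : hom M Q) (k : hom X M) :
  (forall (Z : C) (u v : hom Z M), c ∘ u = c ∘ v -> u = v) ->
  regular_epi (c ∘ k) -> is_iso c.
Proof.
move=> cmono ck.
have [|t tck] := regular_epi_factor (a := k) ck.
  by move=> Z u v; rewrite -!comp_assoc; exact: cmono.
have ct : c ∘ t = idm Q.
  by apply: (regular_epi_epi ck); rewrite -comp_assoc tck comp_idl.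
by exists t; split=> //; apply: cmono; rewrite comp_assoc ct comp_idl comp_idr.
Qed.

Lemma pb_pair (C : fc_category) (X Y Z T : C) (f : hom X Z) (g : hom Y Z)
    (a : hom T X) (b : hom T Y) :
  f ∘ a = g ∘ b -> exists w : hom T (pb f g), pb1 f g ∘ w = a /\ pb2 f g ∘ w = b.
Proof. by move=> e; exists (pb_lift e); rewrite pb1_lift pb2_lift. Qed.

Lemma pullback_ext (C : category) (X Y Z P : C) (f : hom X Z) (g : hom Y Z)
    (p : hom P X) (q : hom P Y) : is_pullback f g p q ->
  forall (T : C) (u v : hom T P), p ∘ u = p ∘ v -> q ∘ u = q ∘ v -> u = v.
Proof.
move=> [fpgq U] T u v pu qu.
have [|w [_ wU]] := U T (p ∘ v) (q ∘ v).
  by rewrite !comp_assoc fpgq.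
by rewrite -(wU u (conj pu qu)) (wU v).
Qed.

(** * Descent along f in an efficiently regular category *)

Section Descent.
Variables (C : fc_category) (X Y B : C) (f : hom X Y) (p : hom B X).

Local Notation S := (pb (f ∘ p) f).
Local Notation d0 := (pb1 (f ∘ p) f).
Local Notation tgt := (pb2 (f ∘ p) f).

(** Elements of S are pairs (b, y) with f (p b) = f y. The three clauses say
    p theta(b, y) = y, theta(b, p b) = b and theta(theta(b, y), z) = theta(b, z).
    Equivalently, theta is a descent datum for p along the kernel pair of f. *)
Record descent_action (theta : hom S B) : Prop := DescentAction {
  action_over : p ∘ theta = tgt;
  action_unit : forall (Z : C) (w : hom Z S),
    tgt ∘ w = p ∘ (d0 ∘ w) -> theta ∘ w = d0 ∘ w;
  action_assoc : forall (Z : C) (w w' w'' : hom Z S),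
    d0 ∘ w' = theta ∘ w -> d0 ∘ w'' = d0 ∘ w -> tgt ∘ w' = tgt ∘ w'' ->
    theta ∘ w' = theta ∘ w''
}.

Variables (theta : hom S B) (th : descent_action theta).

(** Symmetry and transitivity express that b can be recovered from b' = theta(b, y)
    as theta(b', p b), and that iterated transports compose. *)
Lemma action_equivalence : equivalence_relation d0 theta.
Proof.
have [pth thu tha] := th.
split; [|split; [|split]].
- move=> T a b e0 e1; apply: pb_ext => //.
  by rewrite -pth -!comp_assoc e1.
- have [|r [r0 r1]] := pb_pair (f := f ∘ p) (g := f) (a := idm B) (b := p).
    by rewrite comp_idr.
  by exists r; split=> //; rewrite thu // r0 ?r1 ?comp_idr.
- have [|s [s0 s1]] := pb_pair (f := f ∘ p) (g := f) (a := theta) (b := p ∘ d0).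
    by rewrite -comp_assoc pth -pb_comm comp_assoc.
  have [|r [r0 r1]] := pb_pair (f := f ∘ p) (g := f) (a := d0) (b := p ∘ d0).
    by rewrite comp_assoc.
  exists s; split=> //.
  rewrite (tha _ (idm _) s r) ?comp_idr ?s1 ?r1 //.
  by rewrite thu // r1 r0.
- have [|t [t0 t1]] := pb_pair (f := f ∘ p) (g := f)
      (a := d0 ∘ pb1 theta d0) (b := tgt ∘ pb2 theta d0).
    rewrite comp_assoc pb_comm -comp_assoc -pth -comp_assoc pb_comm !comp_assoc.
    by rewrite pb_comm -pth comp_assoc.
  exists t; split=> //; symmetry.
  by apply: (tha _ (pb1 theta d0)); rewrite ?pb_comm.
Qed.

(** A pair (b, b') in the kernel pair of f p is of the form (b, theta(b, y)) exactly
    when b' = theta(b, p b'), which is an equation between two maps to B. *)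
Lemma action_effective_mono :
  exists m : hom S (pb (f ∘ p) (f ∘ p)),
    pb1 (f ∘ p) (f ∘ p) ∘ m = d0 /\ pb2 (f ∘ p) (f ∘ p) ∘ m = theta /\
    effective_mono m.
Proof.
have [pth thu tha] := th.
set k0 := pb1 _ _; set k1 := pb2 (f ∘ p) (f ∘ p).
have kE : f ∘ p ∘ k0 = f ∘ p ∘ k1 by exact: pb_comm.
have [|m [m0 m1]] := pb_pair (f := f ∘ p) (g := f ∘ p) (a := d0) (b := theta).
  by rewrite pb_comm -comp_assoc pth.
have [|c [c0 c1]] := pb_pair (f := f ∘ p) (g := f) (a := k0) (b := p ∘ k1).
  by rewrite kE comp_assoc.
exists m; split=> //; split=> //.
exists B, k1, (theta ∘ c); split.
  have cm : c ∘ m = idm S.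
    apply: pb_ext; rewrite comp_assoc comp_idr; first by rewrite c0 m0.
    by rewrite c1 -comp_assoc m1 pth.
  by rewrite -comp_assoc cm m1 comp_idr.
move=> T a aE; exists (c ∘ a); split.
  apply: pb_ext; rewrite !comp_assoc -/k0 -/k1; first by rewrite m0 c0.
  by rewrite m1 -aE.
move=> b ba; rewrite -ba; apply: pb_ext; rewrite !comp_assoc.
- by rewrite c0 m0.
- by rewrite c1 -(comp_assoc p) m1 pth.
Qed.

Hypothesis Ceff : efficiently_regular C.

(** The Barr-Kock argument. The comparison c : B -> X x_Y D is a monomorphism, since
    two elements identified by q are of the form b, theta(b, y), and then agree as soon
    as they lie over the same element of X. It is a strong epimorphism, since an
    element (x, d) with d = q b is the image of theta(b, x), and such a b exists
    after pulling back along the regular epimorphism q. *)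
Lemma descent_quotient :
  exists (D : C) (g : hom D Y) (q : hom B D),
    is_pullback f g p q /\ q ∘ theta = q ∘ d0.
Proof.
have [[kcoeq stab] eff] := Ceff.
have [pth thu tha] := th.
have [m [m0 [m1 meff]]] := action_effective_mono.
have [E [h hK]] :=
  eff _ _ _ _ action_equivalence _ _ _ _ _ (pb_is_pullback (f ∘ p) (f ∘ p)) m m0 m1 meff.
have [D [q qco]] := kcoeq _ _ _ _ _ _ hK.
have qre : regular_epi q by exists S, d0, theta.
have [qE qU] := qco.
have [g [gE _]] : exists! g, g ∘ q = f ∘ p.
  by apply: qU; rewrite pb_comm -comp_assoc pth.
(* q has the same kernel pair as h, because h factors through q *)
have qS Z (a b : hom Z B) : q ∘ a = q ∘ b -> exists w : hom Z S, d0 ∘ w = a /\ theta ∘ w = b.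
  move=> ab; have [h' [hq _]] := qU E h (proj1 hK).
  have [|w [wE _]] := (proj2 hK) Z a b; last by exists w.
  by rewrite -hq -!comp_assoc ab.
exists D, g, q; split; last by rewrite qE.
have [c [c1 c2]] := pb_pair (eq_sym gE).
have [c' [c'c cc']] : is_iso c.
  have [|w [w0 w1]] := pb_pair (f := f ∘ p) (g := f)
      (a := pb1 q (pb2 f g)) (b := pb1 f g ∘ pb2 q (pb2 f g)).
    by rewrite -gE -comp_assoc pb_comm !comp_assoc pb_comm.
  apply: (mono_strong_iso (k := theta ∘ w)).
    move=> Z u v uv.
    have [|x [x0 x1]] := qS Z u v; first by rewrite -c2 -!comp_assoc uv.
    rewrite -x1 thu ?x0 // -pth -comp_assoc x1 -c1 -!comp_assoc.
    by rewrite uv.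
  suff -> : c ∘ (theta ∘ w) = pb2 q (pb2 f g).
    exact: stab (pb_is_pullback q (pb2 f g)) qre.
  apply: pb_ext; rewrite comp_assoc; first by rewrite c1 comp_assoc pth w1.
  by rewrite c2 comp_assoc -qE -comp_assoc w0 pb_comm.
split=> // T a b ab.
have [w [w1 w2]] := pb_pair ab.
exists (c' ∘ w); split.
  by rewrite -c1 -c2 -!(comp_assoc _ c) !(whisker cc') !comp_idl.
move=> u [u1 u2].
have -> : w = c ∘ u by apply: pb_ext; rewrite comp_assoc ?c1 ?c2 ?w1 ?w2.
by rewrite comp_assoc c'c comp_idl.
Qed.

End Descent.

(** * Universal families and transport *)

Section Families.
Variables (C : fc_category) (X Y : C) (f : hom X Y).

Local Notation pairs T := (pb (f ∘ pmap T) f).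
Local Notation fst_ T := (pb1 (f ∘ pmap T) f).
Local Notation snd_ T := (pb2 (f ∘ pmap T) f).

(** A map of points p0^* T -> p1^* A over the kernel pair of f, written
    (t, y) |-> kappa(t, y) in A_y for t in T_x and x ~ y, with kappa(0_x, y) = 0_y. *)
Definition family (T A : Pt X) (kappa : hom (pairs T) (pdom A)) : Prop :=
  pmap A ∘ kappa = snd_ T /\
  forall (Z : C) (w : hom Z (pairs T)) (x : hom Z X),
    fst_ T ∘ w = psec T ∘ x -> kappa ∘ w = psec A ∘ (snd_ T ∘ w).

(** ev(u t, y) = kappa(t, y). *)
Definition classifies (T A B : Pt X) (ev : hom (pairs B) (pdom A))
    (kappa : hom (pairs T) (pdom A)) (u : hom T B) : Prop :=
  forall (Z : C) (v : hom Z (pairs B)) (w : hom Z (pairs T)),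
    fst_ B ∘ v = ph u ∘ (fst_ T ∘ w) -> snd_ B ∘ v = snd_ T ∘ w ->
    ev ∘ v = kappa ∘ w.

(** This is the couniversal property of a counit p0^* B -> p1^* A at p1^* A, stated
    without reference to a chosen kernel pair. *)
Record universal_family (A B : Pt X) (ev : hom (pairs B) (pdom A)) : Prop :=
  UniversalFamily {
  ev_family : family ev;
  ev_exists : forall (T : Pt X) (kappa : hom (pairs T) (pdom A)),
    family kappa -> exists u : hom T B, classifies ev kappa u;
  ev_unique : forall (T : Pt X) (u u' : hom T B),
    (forall (Z : C) (t : hom Z (pdom T)) (v v' : hom Z (pairs B)),
      fst_ B ∘ v = ph u ∘ t -> fst_ B ∘ v' = ph u' ∘ t ->
      snd_ B ∘ v = snd_ B ∘ v' -> ev ∘ v = ev ∘ v') ->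
    u = u'
}.

Lemma spread_sec_comm (T : Pt X) : f ∘ pmap T ∘ psec T = f ∘ idm X.
Proof. by rewrite -comp_assoc pmap_sec. Qed.

(** The underlying object over X is f^* of T viewed over Y. The diagonal provides a
    section, so that [ev_exists] and [ev_unique] apply to maps out of it. *)
Definition spread (T : Pt X) : Pt X.
Proof. exists (pairs T) (snd_ T) (pb_lift (spread_sec_comm T)); exact: pb2_lift. Defined.

Lemma spread_sec (T : Pt X) : fst_ T ∘ psec (spread T) = psec T.
Proof. exact: pb1_lift. Qed.

Lemma pairs_ext (T : Pt X) (Z : C) (u v : hom Z (pairs T)) :
  fst_ T ∘ u = fst_ T ∘ v -> snd_ T ∘ u = snd_ T ∘ v -> u = v.
Proof. exact: pb_ext. Qed.

Lemma pairs_pair (T : Pt X) (Z : C) (t : hom Z (pdom T)) (x : hom Z X) :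
  f ∘ (pmap T ∘ t) = f ∘ x ->
  exists w : hom Z (pairs T), fst_ T ∘ w = t /\ snd_ T ∘ w = x.
Proof. by rewrite comp_assoc; exact: pb_pair. Qed.

Lemma pairs_comm (T : Pt X) (Z : C) (w : hom Z (pairs T)) :
  f ∘ (pmap T ∘ (fst_ T ∘ w)) = f ∘ (snd_ T ∘ w).
Proof. by rewrite !comp_assoc pb_comm. Qed.

Lemma pairs_square (T : Pt X) : f ∘ (pmap T ∘ fst_ T) = f ∘ snd_ T.
Proof. by rewrite comp_assoc pb_comm. Qed.

Lemma spread_comm (T : Pt X) :
  f ∘ (snd_ T ∘ fst_ (spread T)) = f ∘ snd_ (spread T).
Proof. exact: pairs_square (spread T). Qed.

Variables (A B : Pt X) (ev : hom (pairs B) (pdom A)) (evU : universal_family ev).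

(** [ev_unique] with the compatibilities separated from the maps: the composites that
    get compared below are arrows of the base category which are seen to be maps of
    points only afterwards. *)
Lemma universal_family_ext (T : Pt X) (u u' : hom (pdom T) (pdom B)) :
  pmap B ∘ u = pmap T -> pmap B ∘ u' = pmap T ->
  u ∘ psec T = psec B -> u' ∘ psec T = psec B ->
  (forall (Z : C) (t : hom Z (pdom T)) (v v' : hom Z (pairs B)),
    fst_ B ∘ v = u ∘ t -> fst_ B ∘ v' = u' ∘ t ->
    snd_ B ∘ v = snd_ B ∘ v' -> ev ∘ v = ev ∘ v') ->
  u = u'.
Proof.
move=> m m' s s' e.
exact: (f_equal (@ph _ _ _ _) (ev_unique evU (u := PointHom m s) (u' := PointHom m' s') e)).
Qed.

(** ev(theta(b, y), z) = ev(b, z). *)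
Definition preserves_ev (theta : hom (pairs B) (pdom B)) : Prop :=
  forall (Z : C) (w v v' : hom Z (pairs B)),
    fst_ B ∘ v = theta ∘ w -> fst_ B ∘ v' = fst_ B ∘ w ->
    snd_ B ∘ v = snd_ B ∘ v' -> ev ∘ v = ev ∘ v'.

(** theta(0_x, y) = 0_y. The section of [spread B] covers only the case x = y, so this
    is not part of theta being a map of points out of [spread B]. *)
Definition preserves_zero (theta : hom (pairs B) (pdom B)) : Prop :=
  forall (Z : C) (w : hom Z (pairs B)) (x : hom Z X),
    fst_ B ∘ w = psec B ∘ x -> theta ∘ w = psec B ∘ (snd_ B ∘ w).

(** theta classifies the family ((b, y), z) |-> ev(b, z) on [spread B]. *)
Lemma transport_exists : exists theta : hom (spread B) B, preserves_ev (ph theta).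
Proof.
have [ev1 ev2] := ev_family evU.
have [|c [c0 c1]] := pairs_pair (T := B) (t := fst_ B ∘ fst_ (spread B)) (x := snd_ (spread B)).
  by rewrite pairs_comm spread_comm.
have [|theta thE] := ev_exists evU (T := spread B) (kappa := ev ∘ c).
  split; first by rewrite comp_assoc ev1.
  move=> Z w x wx; rewrite -comp_assoc (ev2 _ _ x) (comp_assoc _ c) ?c1 //.
  by rewrite c0 -comp_assoc wx comp_assoc spread_sec.
exists theta => Z w v v' v0 v'0 vv'.
have [|w' [w'0 w'1]] := pairs_pair (T := spread B) (t := w) (x := snd_ B ∘ v).
  by rewrite vv' /= -[LHS]pairs_comm -v'0 pairs_comm.
rewrite (thE _ v w') ?w'0 ?w'1 // -comp_assoc; congr (_ ∘ _).
by apply: pairs_ext; rewrite comp_assoc ?c0 ?c1 -?comp_assoc ?w'0 ?w'1.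
Qed.

(** Both (x, y) |-> theta(0_x, y) and (x, y) |-> 0_y are maps of points from the kernel
    pair of f, with second projection and diagonal, to B, and both evaluate to zero. *)
Lemma transport_zero (theta : hom (spread B) B) :
  preserves_ev (ph theta) -> preserves_zero (ph theta).
Proof.
move=> thE Z w x wx.
have [ev1 ev2] := ev_family evU.
pose E := Pt_one X; pose O := spread E.
have [|c [c0 c1]] := pairs_pair (T := B) (t := psec B ∘ fst_ E) (x := snd_ E).
  rewrite (whisker (pmap_sec B)) -pb_comm /= comp_idl comp_idr //.
have cs : c ∘ psec O = psec (spread B).
  apply: pairs_ext; rewrite comp_assoc ?c0 ?c1.
    by rewrite -comp_assoc !spread_sec comp_idr.
  exact: (eq_trans (pmap_sec O) (eq_sym (pmap_sec (spread B)))).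
have cE : ph theta ∘ c = psec B ∘ snd_ E.
{ apply: (universal_family_ext (T := O)).
  - by rewrite comp_assoc ph_map.
  - by rewrite comp_assoc pmap_sec comp_idl.
  - by rewrite -comp_assoc cs ph_sec.
  - by rewrite -comp_assoc (pmap_sec O) comp_idr.
  - move=> V t v v'; rewrite -!comp_assoc => v0 v'0 vv'.
  have [|v'' [v''0 v''1]] := pairs_pair (T := B) (t := fst_ B ∘ (c ∘ t)) (x := snd_ B ∘ v).
    by rewrite -pairs_comm v0 (whisker (ph_map theta)) pairs_comm.
  rewrite (thE _ (c ∘ t) v v'') //.
  rewrite (ev2 _ v'' (fst_ E ∘ t)); first by rewrite v''0 !comp_assoc c0.
  by rewrite v''1 vv' (ev2 _ v' (snd_ E ∘ t)). }
have [|y [y0 y1]] := pairs_pair (T := E) (t := x) (x := snd_ B ∘ w).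
  rewrite /= comp_idl -pairs_comm wx (whisker (pmap_sec B)) comp_idl //.
have -> : w = c ∘ y.
  by apply: pairs_ext; rewrite comp_assoc ?c0 ?c1 -?comp_assoc ?y0 ?y1.
by rewrite (whisker cE) (whisker c1) comp_assoc.
Qed.

(** The unit law compares two endomorphisms of the point B, the cocycle law two maps of
    points [spread (spread B)] -> B; preservation of zero is what makes
    ((b, y), z) |-> theta(theta(b, y), z) and ((b, y), z) |-> theta(b, z) respect
    sections. *)
Lemma transport_action : exists theta : hom (pairs B) (pdom B),
  descent_action theta /\ preserves_zero theta /\ preserves_ev theta.
Proof.
have [theta thE] := transport_exists.
have th0 := transport_zero thE.
have thm : pmap B ∘ theta = snd_ B by exact: (ph_map theta).
exists theta; split=> //; split=> //.
- have [|c [c0 c1]] := pairs_pair (T := B) (t := idm _) (x := pmap B).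
    by rewrite comp_idr.
  have tc : ph theta ∘ c = idm _.
  { apply: (universal_family_ext (T := B)).
    + by rewrite comp_assoc thm.
    + by rewrite comp_idr.
    + rewrite -comp_assoc (th0 _ _ (idm _)).
        by rewrite (whisker c0) comp_idl comp_idr.
      by rewrite (whisker c1) pmap_sec comp_idr.
    + exact: comp_idl.
    + move=> Z t v v'; rewrite -!comp_assoc => v0 v'0 vv'; apply: (thE _ (c ∘ t)) => //.
      by rewrite v'0 (whisker c0). }
  move=> Z w wE.
  have -> : w = c ∘ (fst_ B ∘ w).
    by apply: pairs_ext; rewrite (comp_assoc _ c) ?c0 ?c1 ?comp_idl.
  by rewrite comp_assoc tc (comp_assoc _ c) c0 comp_idl.
- pose S := spread B.
  have [|a [a0 a1]] := pairs_pair (T := B) (t := ph theta ∘ fst_ S) (x := snd_ S).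
    by rewrite (whisker thm) spread_comm.
  have [|b [b0 b1]] := pairs_pair (T := B) (t := fst_ B ∘ fst_ S) (x := snd_ S).
    by rewrite pairs_comm spread_comm.
  have ab : ph theta ∘ a = ph theta ∘ b.
  { apply: (universal_family_ext (T := spread S)).
    + by rewrite comp_assoc thm.
    + by rewrite comp_assoc thm.
    + rewrite -comp_assoc (th0 _ _ (idm _)).
        by rewrite (whisker a0) -comp_assoc spread_sec ph_sec comp_idr.
      by rewrite (whisker a1) (pmap_sec (spread S)) comp_idr.
    + rewrite -comp_assoc (th0 _ _ (idm _)).
        by rewrite (whisker b0) -comp_assoc !spread_sec comp_idr.
      by rewrite (whisker b1) (pmap_sec (spread S)) comp_idr.
    + move=> Z t v v'; rewrite -!comp_assoc => v0 v'0 vv'.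
    have [|x [x0 x1]] := pairs_pair (T := B) (t := fst_ B ∘ (a ∘ t)) (x := snd_ B ∘ v).
      by rewrite -pairs_comm v0 (whisker thm) pairs_comm.
    have [|y [y0 y1]] := pairs_pair (T := B) (t := fst_ B ∘ (b ∘ t)) (x := snd_ B ∘ v').
      by rewrite -pairs_comm v'0 (whisker thm) pairs_comm.
    rewrite (thE _ (a ∘ t) v x) //.
    rewrite (thE _ (b ∘ t) v' y) //.
    apply: (thE _ (fst_ S ∘ t)).
      * by rewrite x0 comp_assoc a0 comp_assoc.
      * by rewrite y0 comp_assoc b0 comp_assoc.
      * by rewrite x1 y1. }
  move=> Z w w' w'' w'0 w''0 w1.
  have [|z [z0 z1]] := pairs_pair (T := S) (t := w) (x := snd_ B ∘ w').
    by rewrite /= -[RHS]pairs_comm w'0 (whisker thm).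
  have -> : w' = a ∘ z.
    by apply: pairs_ext; rewrite comp_assoc ?a0 ?a1 -?comp_assoc ?z0 ?z1.
  have -> : w'' = b ∘ z.
    by apply: pairs_ext; rewrite comp_assoc ?b0 ?b1 -?comp_assoc ?z0 ?z1.
  by rewrite !comp_assoc ab.
Qed.

End Families.

(** * Descending a universal family to a couniversal arrow *)

Section DescentOfUniversalFamily.
Variables (C : fc_category) (X Y : C) (f : hom X Y).

Local Notation pairs T := (pb (f ∘ pmap T) f).
Local Notation fst_ T := (pb1 (f ∘ pmap T) f).
Local Notation snd_ T := (pb2 (f ∘ pmap T) f).
Local Notation fstar := (change_of_base f).
Local Notation inX T := (pb1 f (pmap T)).
Local Notation inT T := (pb2 f (pmap T)).

Variables (A B : Pt X) (ev : hom (pairs B) (pdom A)) (evU : universal_family ev).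

(** ev(u(x, t), y) = k(y, t): under the adjunction p0^* -| Phi_p0, u corresponds to
    p0^* f^* T = p1^* f^* T -> p1^* A. *)
Definition mate (T : Pt Y) (k : hom (fstar T) A) (u : hom (fstar T) B) : Prop :=
  forall (Z : C) (w w' : hom Z (pb f (pmap T))) (v : hom Z (pairs B)),
    inT T ∘ w = inT T ∘ w' ->
    fst_ B ∘ v = ph u ∘ w -> snd_ B ∘ v = inX T ∘ w' -> ev ∘ v = ph k ∘ w'.

Lemma base_map (T : Pt Y) (E : Pt X) (k : hom (fstar T) E) : pmap E ∘ ph k = inX T.
Proof. exact: (ph_map k). Qed.

Lemma base_psec1 (T : Pt Y) : inX T ∘ psec (fstar T) = idm X.
Proof. exact: pb1_lift. Qed.

Lemma base_psec2 (T : Pt Y) : inT T ∘ psec (fstar T) = psec T ∘ f.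
Proof. exact: pb2_lift. Qed.

Lemma base_square (T : Pt Y) (Z : C) (z : hom Z (pb f (pmap T))) :
  f ∘ (inX T ∘ z) = pmap T ∘ (inT T ∘ z).
Proof. by rewrite !comp_assoc pb_comm. Qed.

Lemma mate_exists (T : Pt Y) (k : hom (fstar T) A) : exists u, mate k u.
Proof.
pose E := fstar T.
have [|c [c1 c2]] := pb_pair (f := f) (g := pmap T) (a := snd_ E) (b := inT T ∘ fst_ E).
  by rewrite -(pairs_square f E) !comp_assoc (pb_comm f (pmap T)).
have [|u uE] := ev_exists evU (T := E) (kappa := ph k ∘ c).
  split; first by rewrite comp_assoc base_map.
  move=> Z w x wx.
  suff cw : c ∘ w = psec E ∘ (snd_ E ∘ w).
    by rewrite -comp_assoc cw (whisker (ph_sec k)).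
  have fx : f ∘ x = f ∘ (snd_ E ∘ w).
    by rewrite -pairs_comm wx (whisker (pmap_sec E)) comp_idl.
  apply: pb_ext; first by rewrite comp_assoc c1 (whisker (base_psec1 T)) comp_idl.
  rewrite comp_assoc c2 -comp_assoc wx !(whisker (base_psec2 T)).
  by rewrite -!comp_assoc fx.
exists u => Z w w' v ww' v0 v1.
have [|x [x0 x1]] := pairs_pair (f := f) (T := E) (t := w) (x := inX T ∘ w').
  by rewrite /= !base_square ww'.
rewrite (uE _ v x) ?x0 ?x1 // -comp_assoc; congr (_ ∘ _).
by apply: pb_ext; rewrite comp_assoc ?c1 ?c2 -?comp_assoc ?x0 ?x1.
Qed.

Lemma mate_unique (T : Pt Y) (k : hom (fstar T) A) (u u' : hom (fstar T) B) :
  mate k u -> mate k u' -> u = u'.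
Proof.
move=> uk u'k; apply: (ev_unique evU) => Z t v v' v0 v'0 vv'.
have [|w [w1 w2]] := pb_pair (f := f) (g := pmap T) (a := snd_ B ∘ v) (b := inT T ∘ t).
  by rewrite -pairs_comm v0 (whisker (base_map u)) base_square.
by rewrite (uk _ t w v) ?(u'k _ t w v') ?w1 ?w2.
Qed.

Lemma mate_comp (T T' : Pt Y) (i : hom T' T) (k : hom (fstar T) A)
    (u : hom (fstar T) B) :
  mate k u -> mate (k ∘ fmap fstar i) (u ∘ fmap fstar i).
Proof.
move=> ku Z w w' v ww' v0 v1.
have i1 : inX T ∘ ph (fmap fstar i) = inX T' by exact: pb1_lift.
have i2 : inT T ∘ ph (fmap fstar i) = ph i ∘ inT T' by exact: pb2_lift.
rewrite -comp_assoc; apply: (ku _ (ph (fmap fstar i) ∘ w)).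
- by rewrite !(whisker i2) -!comp_assoc ww'.
- by rewrite v0 -comp_assoc.
- by rewrite v1 (whisker i1).
Qed.

(** Since k(z, t) involves only t, the maps ((x, t), y) |-> theta(u(x, t), y) and
    ((x, t), y) |-> u(y, t) out of [spread (f^* T)] have the same evaluation. *)
Lemma mate_transport (theta : hom (pairs B) (pdom B)) :
  descent_action theta -> preserves_zero theta -> preserves_ev ev theta ->
  forall (T : Pt Y) (k : hom (fstar T) A) (u : hom (fstar T) B), mate k u ->
  forall (Z : C) (w w' : hom Z (pb f (pmap T))) (v : hom Z (pairs B)),
    inT T ∘ w = inT T ∘ w' ->
    fst_ B ∘ v = ph u ∘ w -> snd_ B ∘ v = inX T ∘ w' -> theta ∘ v = ph u ∘ w'.
Proof.
move=> [thm _ _] th0 thE T k u ku Z w w' v ww' v0 v1.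
pose E := fstar T.
have [|a [a0 a1]] := pairs_pair (f := f) (T := B) (t := ph u ∘ fst_ E) (x := snd_ E).
  by rewrite (whisker (base_map u)) (pairs_square f E).
have [|b [b1 b2]] := pb_pair (f := f) (g := pmap T) (a := snd_ E) (b := inT T ∘ fst_ E).
  by rewrite -(pairs_square f E) !comp_assoc (pb_comm f (pmap T)).
have ab : theta ∘ a = ph u ∘ b.
{ apply: (universal_family_ext evU (T := spread f E)).
  - by rewrite comp_assoc thm.
  - by rewrite comp_assoc base_map.
  - rewrite -comp_assoc (th0 _ _ (idm _)).
      by rewrite (whisker a0) -comp_assoc spread_sec (ph_sec u) comp_idr.
    by rewrite (whisker a1) (pmap_sec (spread f E)) comp_idr.
  - suff bs : b ∘ psec (spread f E) = psec E by rewrite -comp_assoc bs (ph_sec u).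
    apply: pb_ext.
      by rewrite (whisker b1) (pmap_sec (spread f E)) base_psec1.
    by rewrite (whisker b2) -comp_assoc spread_sec.
  - move=> V t y y'; rewrite -!comp_assoc => y0 y'0 yy'.
    have [|z [z0 z1]] := pairs_pair (f := f) (T := B) (t := fst_ B ∘ (a ∘ t)) (x := snd_ B ∘ y).
      by rewrite -[RHS]pairs_comm y0 (whisker thm) pairs_comm.
    have [|x [x1 x2]] := pb_pair (f := f) (g := pmap T) (a := snd_ B ∘ y) (b := inT T ∘ (b ∘ t)).
      by rewrite yy' -pairs_comm y'0 (whisker (base_map u)) base_square.
    rewrite (thE _ (a ∘ t) y z) // (ku _ (fst_ E ∘ t) x z) ?z1 ?x1 //.
    + by rewrite x2 (whisker b2) comp_assoc.
    + by rewrite z0 (whisker a0) comp_assoc.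
    + by rewrite (ku _ (b ∘ t) x y') ?x2 -?yy' ?x1. }
have [|x [x0 x1]] := pairs_pair (f := f) (T := E) (t := w) (x := inX T ∘ w').
  by rewrite /= !base_square ww'.
have -> : v = a ∘ x.
  by apply: pairs_ext; rewrite ?(whisker a0) ?(whisker a1) -?comp_assoc ?x0 ?x1.
have -> : w' = b ∘ x.
  by apply: pb_ext; rewrite ?(whisker b1) ?(whisker b2) -?comp_assoc ?x0 ?x1.
by rewrite !comp_assoc ab.
Qed.

Hypothesis Ceff : efficiently_regular C.
Hypothesis fre : regular_epi f.

(** D is the quotient of B by transport and e is b |-> ev(b, p b) under f^* D = B. A map
    k : f^* T -> A transposes to the map T -> D induced by q u, where u is the mate of k;
    conversely j f^* l is the mate of e f^* l for every l : T -> D, so l is determined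
    by e f^* l because f^* T -> T is an epimorphism. *)
Lemma descended_couniversal :
  exists (D : Pt Y) (j : hom (fstar D) B) (e : hom (fstar D) A),
    is_iso j /\ mate e j /\ couniversal e.
Proof.
have fepi := regular_epi_epi fre.
have [theta [th [th0 thE]]] := transport_action evU.
have [thm thu tha] := th.
have [D0 [g [q [gqP qth]]]] := descent_quotient th Ceff.
have [gq _] := gqP.
have qS Z (v : hom Z (pairs B)) : q ∘ (fst_ B ∘ v) = q ∘ (theta ∘ v).
  by rewrite !comp_assoc qth.
(* q 0_u = q theta(0_u, v) = q 0_v when u ~ v, so the section of B descends along f *)
have [|sg sgE] := regular_epi_factor (a := q ∘ psec B) fre.
  move=> Z u v uv.
  have [|w [w0 w1]] := pairs_pair (f := f) (T := B) (t := psec B ∘ u) (x := v).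
    by rewrite (whisker (pmap_sec B)) comp_idl.
  by rewrite -!comp_assoc -w0 qS (th0 _ _ u) // w1.
have gsg : g ∘ sg = idm Y.
  by apply: fepi; rewrite -comp_assoc sgE comp_assoc -gq -comp_assoc pmap_sec comp_idl comp_idr.
pose D : Pt Y := Point gsg.
have [j0 [[j01 j02] _]] := proj2 gqP _ _ _ (pb_comm f g).
have [j0' [j0'1 j0'2]] := pb_pair gq.
have qext := pullback_ext gqP.
have jj' : j0 ∘ j0' = idm _.
  by apply: qext; rewrite comp_idr ?(whisker j01) ?(whisker j02).
have j'j : j0' ∘ j0 = idm _.
  by apply: pb_ext; rewrite comp_idr ?(whisker j0'1) ?(whisker j0'2).
have jsec : j0 ∘ psec (fstar D) = psec B.
  apply: qext.
    by rewrite (whisker j01) (base_psec1 D) pmap_sec.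
  by rewrite (whisker j02) (base_psec2 D).
have j'sec : j0' ∘ psec B = psec (fstar D).
  by rewrite -jsec comp_assoc j'j comp_idl.
pose j : hom (fstar D) B := @PointHom C X (fstar D) B j0 j01 jsec.
pose j' : hom B (fstar D) := @PointHom C X B (fstar D) j0' j0'1 j'sec.
have jiso : is_iso j.
  by exists j'; split; apply: point_hom_ext.
(* dg(x, d) is the pair (b, x), where b in B_x corresponds to (x, d) *)
have [|dg [dg0 dg1]] := pairs_pair (f := f) (T := B) (t := j0) (x := inX D).
  by rewrite j01.
have [ev1 ev2] := ev_family evU.
have em : pmap A ∘ (ev ∘ dg) = inX D by rewrite comp_assoc ev1 dg1.
have es : ev ∘ dg ∘ psec (fstar D) = psec A.
  rewrite -comp_assoc (ev2 _ _ (idm X)).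
    by rewrite (whisker dg0) jsec comp_idr.
  by rewrite (whisker dg1) (base_psec1 D) comp_idr.
pose e : hom (fstar D) A := @PointHom C X (fstar D) A (ev ∘ dg) em es.
have je : mate e j.
{ move=> Z w w' v ww' v0 v1; rewrite /= -comp_assoc; symmetry.
  apply: (thE _ v).
  - rewrite (whisker dg0); apply: qext.
      by rewrite (whisker j01) (whisker thm) v1.
    by rewrite -qS v0 /= !(whisker j02) ww'.
  - by [].
  - by rewrite (whisker dg1) v1. }
exists D, j, e; split=> //; split=> //.
move=> T k.
have pTre : regular_epi (inT T).
  exact: (proj2 (proj1 Ceff)) (pb_is_pullback f (pmap T)) fre.
have pTepi := regular_epi_epi pTre.
have [u ku] := mate_exists k.
have [|l0 l0E] := regular_epi_factor (a := q ∘ ph u) pTre.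
  move=> Z w w' ww'; rewrite -!comp_assoc.
  have [|v [v0 v1]] := pairs_pair (f := f) (T := B) (t := ph u ∘ w) (x := inX T ∘ w').
    by rewrite (whisker (base_map u)) !base_square ww'.
  by rewrite -(mate_transport th th0 thE ku ww' v0 v1) -qS v0.
have l0m : g ∘ l0 = pmap T.
  apply: pTepi; rewrite -comp_assoc l0E comp_assoc -gq -comp_assoc (base_map u).
  exact: pb_comm.
have l0s : l0 ∘ psec T = sg.
  apply: fepi; rewrite -comp_assoc -(base_psec2 T) comp_assoc l0E sgE -comp_assoc.
  by rewrite (ph_sec u).
have jl (l : hom T D) : q ∘ ph (j ∘ fmap fstar l) = ph l ∘ inT T.
  by rewrite /= (whisker j02) pb2_lift.
pose l : hom T D := @PointHom C Y T D l0 l0m l0s.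
have jlu : j ∘ fmap fstar l = u.
  apply: point_hom_ext; apply: qext; last by rewrite jl l0E.
  by rewrite base_map (base_map u).
exists l; split.
- apply: point_hom_ext.
  rewrite -[RHS]comp_idr /= -comp_assoc; apply: (ku _ (idm _)) => //.
  + by rewrite (whisker dg0) comp_idr -jlu.
  + by rewrite (whisker dg1) (base_map (fmap fstar l)) comp_idr.
- move=> l' l'k; apply: point_hom_ext; apply: pTepi.
  have jl'u : j ∘ fmap fstar l' = u.
    by apply: (mate_unique (k := k)) => //; rewrite -l'k; exact: mate_comp.
  by rewrite -(jl l) -(jl l') jlu jl'u.
Qed.

(** (T, k) is isomorphic to the couniversal arrow (D, e) just constructed, whose mate
    j is invertible. *)
Lemma mate_of_couniversal_iso (T : Pt Y) (k : hom (fstar T) A) (u : hom (fstar T) B) :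
  couniversal k -> mate k u -> is_iso u.
Proof.
move=> kU ku.
have [D [j [e [[j' [j'j jj']] [ej eU]]]]] := descended_couniversal.
have [i [ik _]] := eU T k.
have [i' [i'e _]] := kU D e.
have ii' : i ∘ i' = idm D.
  have [w [_ wU]] := eU D e.
  rewrite -(wU (i ∘ i')) ?(wU (idm D)) ?fmap_id ?comp_idr //.
  by rewrite fmap_comp comp_assoc ik.
have i'i : i' ∘ i = idm T.
  have [w [_ wU]] := kU T k.
  rewrite -(wU (i' ∘ i)) ?(wU (idm T)) ?fmap_id ?comp_idr //.
  by rewrite fmap_comp comp_assoc i'e.
have <- : j ∘ fmap fstar i = u.
  by apply: (mate_unique (k := k)) => //; rewrite -ik; exact: mate_comp.
exists (fmap fstar i' ∘ j'); split.
- by rewrite -comp_assoc (whisker j'j) comp_idl -fmap_comp i'i fmap_id.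
- by rewrite -comp_assoc (comp_assoc (fmap _ i)) -fmap_comp ii' fmap_id comp_idl.
Qed.

End DescentOfUniversalFamily.

(** * From the kernel pair to f *)

Section KernelPair.
Variables (C : fc_category) (X Y R : C) (f : hom X Y) (p0 p1 : hom R X).
Hypothesis kp : is_kernel_pair f p0 p1.

Local Notation pairs T := (pb (f ∘ pmap T) f).
Local Notation fst_ T := (pb1 (f ∘ pmap T) f).
Local Notation snd_ T := (pb2 (f ∘ pmap T) f).
Local Notation inR T := (pb1 p0 (pmap T)).
Local Notation inT T := (pb2 p0 (pmap T)).

Lemma kernel_lift (T : Pt X) (Z : C) (v : hom Z (pairs T)) :
  exists z : hom Z (pb p0 (pmap T)),
    inT T ∘ z = fst_ T ∘ v /\ p1 ∘ (inR T ∘ z) = snd_ T ∘ v.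
Proof.
have [r [[r0 r1] _]] := proj2 kp _ _ _ (pairs_comm v).
have [z [z1 z2]] := pb_pair r0.
by exists z; rewrite z1 z2.
Qed.

Lemma kernel_drop (T : Pt X) (Z : C) (z : hom Z (pb p0 (pmap T))) :
  exists v : hom Z (pairs T),
    fst_ T ∘ v = inT T ∘ z /\ snd_ T ∘ v = p1 ∘ (inR T ∘ z).
Proof.
by apply: pairs_pair; rewrite -base_square (whisker (proj1 kp)) -comp_assoc.
Qed.

Lemma kernel_ext (T : Pt X) (Z : C) (z z' : hom Z (pb p0 (pmap T))) :
  inT T ∘ z = inT T ∘ z' -> p1 ∘ (inR T ∘ z) = p1 ∘ (inR T ∘ z') -> z = z'.
Proof.
move=> e0 e1; apply: pb_ext => //; apply: (pullback_ext kp) => //.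
by rewrite !base_square e0.
Qed.

(** ev(b, y) is the A-component of e at ((x, y), b), for b in B_x. It is stated relationally because a
    kernel pair comes without a chosen pairing of elements x ~ y. *)
Definition evaluates (A B : Pt X) (e : hom (change_of_base p0 B) (change_of_base p1 A))
    (ev : hom (pairs B) (pdom A)) : Prop :=
  forall (Z : C) (v : hom Z (pairs B)) (z : hom Z (pb p0 (pmap B))),
    inT B ∘ z = fst_ B ∘ v -> p1 ∘ (inR B ∘ z) = snd_ B ∘ v ->
    ev ∘ v = pb2 p1 (pmap A) ∘ (ph e ∘ z).

Lemma evaluation_exists (A B : Pt X)
    (e : hom (change_of_base p0 B) (change_of_base p1 A)) :
  exists ev : hom (pairs B) (pdom A), evaluates e ev.
Proof.
have [i [i0 i1]] := kernel_lift (idm (pairs B)).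
exists (pb2 p1 (pmap A) ∘ (ph e ∘ i)) => Z v z z0 z1.
rewrite -!comp_assoc; congr (_ ∘ (_ ∘ _)).
rewrite !comp_idr in i0 i1.
apply: kernel_ext; first by rewrite z0 (whisker i0).
by rewrite z1 (comp_assoc (inR B)) (whisker i1).
Qed.

Lemma evaluation_universal (A B : Pt X)
    (e : hom (change_of_base p0 B) (change_of_base p1 A)) (ev : hom (pairs B) (pdom A)) :
  couniversal e -> evaluates e ev -> universal_family ev.
Proof.
move=> eU evE.
have fmap1 (T : Pt X) (u : hom T B) : inR B ∘ ph (fmap (change_of_base p0) u) = inR T.
  exact: pb1_lift.
have fmap2 (T : Pt X) (u : hom T B) :
    inT B ∘ ph (fmap (change_of_base p0) u) = ph u ∘ inT T.
  exact: pb2_lift.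
split.
- split.
  + have [i [i0 i1]] := kernel_lift (idm (pairs B)).
    rewrite -[ev]comp_idr (evE _ _ i) // -base_square (whisker (base_map e)) i1.
    by rewrite comp_idr.
  + move=> Z w x wx.
    have [z [z0 z1]] := kernel_lift w.
    have zE : z = psec (change_of_base p0 B) ∘ (inR B ∘ z).
      apply: pb_ext; first by rewrite (whisker (base_psec1 p0 B)) comp_idl.
      rewrite (whisker (base_psec2 p0 B)) -comp_assoc base_square z0 wx.
      by rewrite (whisker (pmap_sec B)) comp_idl.
    rewrite (evE _ w z) // zE (whisker (ph_sec e)) (whisker (base_psec2 p1 A)).
    by rewrite -comp_assoc z1.
- move=> T kappa [k1 k2].
  have [c [c0 c1]] := kernel_drop (idm (pb p0 (pmap T))).
  rewrite !comp_idr in c0 c1.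
  have [|k0 [k01 k02]] := pb_pair (f := p1) (g := pmap A) (a := inR T) (b := kappa ∘ c).
    by rewrite (whisker k1) c1.
  have ks : k0 ∘ psec (change_of_base p0 T) = psec (change_of_base p1 A).
    apply: pb_ext.
      by rewrite (whisker k01) base_psec1 (base_psec1 p1 A).
    rewrite (whisker k02) (base_psec2 p1 A) -comp_assoc (k2 _ _ p0).
      by rewrite (whisker c0) (base_psec2 p0 T).
    by rewrite (whisker c1) -comp_assoc (base_psec1 p0 T) comp_idr.
  pose k : hom (change_of_base p0 T) (change_of_base p1 A) :=
    @PointHom C R (change_of_base p0 T) (change_of_base p1 A) k0 k01 ks.
  have [u [uE _]] := eU T k.
  exists u => Z v w v0 v1.
  have [z [z0 z1]] := kernel_lift w.
  have ez : ph e ∘ (ph (fmap (change_of_base p0) u) ∘ z) = k0 ∘ z.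
    by apply: whisker; exact: (f_equal (@ph _ _ _ _) uE).
  rewrite (evE _ v (ph (fmap (change_of_base p0) u) ∘ z)) ?ez.
  + by rewrite (whisker (fmap2 _ u)) -comp_assoc z0 v0.
  + by rewrite (whisker (fmap1 _ u)) z1 v1.
  + rewrite (whisker k02) -comp_assoc; congr (_ ∘ _).
    by apply: pairs_ext; rewrite ?(whisker c0) ?(whisker c1) -?comp_assoc ?z0 ?z1.
- move=> T u u' uu'.
  have [w [_ wU]] := eU T (e ∘ fmap (change_of_base p0) u').
  rewrite -(wU u') // -(wU u) //.
  apply: point_hom_ext; apply: pb_ext.
    by rewrite /= !(whisker (base_map e)) !fmap1.
  have [v [v0 v1]] := kernel_drop (ph (fmap (change_of_base p0) u)).
  have [v' [v'0 v'1]] := kernel_drop (ph (fmap (change_of_base p0) u')).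
  rewrite -(evE _ v) // -(evE _ v') //.
  apply: (uu' _ (inT T)).
  + by rewrite v0 fmap2.
  + by rewrite v'0 fmap2.
  + by rewrite v1 v'1 !fmap1.
Qed.

(** ev'(b t, y) = a ev(t, y), to be applied with b = Phi_p0 (p1^* a). *)
Lemma evaluation_natural (A A' B B' : Pt X)
    (e : hom (change_of_base p0 B) (change_of_base p1 A)) (ev : hom (pairs B) (pdom A))
    (e' : hom (change_of_base p0 B') (change_of_base p1 A')) (ev' : hom (pairs B') (pdom A'))
    (a : hom A A') (b : hom B B') :
  evaluates e ev -> evaluates e' ev' ->
  e' ∘ fmap (change_of_base p0) b = fmap (change_of_base p1) a ∘ e ->
  forall (Z : C) (v : hom Z (pairs B)) (v' : hom Z (pairs B')),
    fst_ B' ∘ v' = ph b ∘ (fst_ B ∘ v) -> snd_ B' ∘ v' = snd_ B ∘ v ->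
    ev' ∘ v' = ph a ∘ (ev ∘ v).
Proof.
move=> evE ev'E sq Z v v' v0 v1.
have [z [z0 z1]] := kernel_lift v.
have b1 : inR B' ∘ ph (fmap (change_of_base p0) b) = inR B by exact: pb1_lift.
have b2 : inT B' ∘ ph (fmap (change_of_base p0) b) = ph b ∘ inT B by exact: pb2_lift.
have a2 : pb2 p1 (pmap A') ∘ ph (fmap (change_of_base p1) a)
          = ph a ∘ pb2 p1 (pmap A) by exact: pb2_lift.
have ez : ph e' ∘ (ph (fmap (change_of_base p0) b) ∘ z)
          = ph (fmap (change_of_base p1) a) ∘ (ph e ∘ z).
  by rewrite [RHS]comp_assoc; apply: whisker; exact: (f_equal (@ph _ _ _ _) sq).
rewrite (evE _ v z) // (ev'E _ v' (ph (fmap (change_of_base p0) b) ∘ z)) ?ez.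
- by rewrite (whisker b2) -comp_assoc z0 v0.
- by rewrite (whisker b1) z1 v1.
- by rewrite (whisker a2) -comp_assoc.
Qed.

Hypothesis Ceff : efficiently_regular C.
Hypothesis fre : regular_epi f.

Lemma kernel_exponentiable :
  algebraically_exponentiable p0 -> algebraically_exponentiable f.
Proof.
move=> [Phi [eta [eps [tri1 tri2]]]]; apply: couniversal_right_adjoint => A.
have eU := counit_couniversal tri1 tri2 (A := change_of_base p1 A).
have [ev evE] := evaluation_exists (eps (change_of_base p1 A)).
have [D [_ [e [_ [_ eD]]]]] :=
  descended_couniversal (evaluation_universal eU evE) Ceff fre.
by exists D, e.
Qed.

(** Naturality in a : A -> A' holds because both composites are mates of
    eps_A' f^* (Phi_f a) = a eps_A, eps being the counit of Phi_f. *)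
Lemma kernel_beck_chevalley (Phi_f : functor (Pt X) (Pt Y))
    (Phi_p0 : functor (Pt R) (Pt X)) :
  is_right_adjoint (change_of_base f) Phi_f ->
  is_right_adjoint (change_of_base p0) Phi_p0 ->
  naturally_isomorphic (functor_comp (change_of_base f) Phi_f)
    (functor_comp Phi_p0 (change_of_base p1)).
Proof.
move=> [etaf [epsf [trif1 trif2]]] [eta [eps [tri1 tri2]]].
pose B A := Phi_p0 (change_of_base p1 A).
pose e A : hom (change_of_base p0 (B A)) (change_of_base p1 A) := eps (change_of_base p1 A).
pose ev A := proj1_sig (constructive_indefinite_description _ (evaluation_exists (e A))).
have evE A : evaluates (e A) (ev A).
  exact: proj2_sig (constructive_indefinite_description _ (evaluation_exists (e A))).
have evU A : universal_family (ev A).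
  have eU : couniversal (e A) by exact: (counit_couniversal tri1 tri2 (A := change_of_base p1 A)).
  exact: evaluation_universal eU (evE A).
pose k A : hom (change_of_base f (Phi_f A)) A := epsf A.
pose u A := proj1_sig (constructive_indefinite_description _ (mate_exists (evU A) (k A))).
have ku A : mate (ev A) (k A) (u A).
  exact: proj2_sig (constructive_indefinite_description _ (mate_exists (evU A) (k A))).
have uN A A' (a : hom A A') :
    u A' ∘ fmap (functor_comp (change_of_base f) Phi_f) a
    = fmap (functor_comp Phi_p0 (change_of_base p1)) a ∘ u A.
  apply: (mate_unique (evU A') (k := k A' ∘ fmap (change_of_base f) (fmap Phi_f a))).
    exact: mate_comp.
  move=> Z w w' v ww' v0 v1.
  have kN : k A' ∘ fmap (change_of_base f) (fmap Phi_f a) = a ∘ k A.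
    exact: (nt_natural epsf a).
  rewrite kN /= -comp_assoc.
  have [|y [y0 y1]] := pairs_pair (f := f) (T := B A) (t := ph (u A) ∘ w) (x := snd_ (B A') ∘ v).
    by rewrite v1 (whisker (base_map (u A))) !base_square ww'.
  rewrite -(ku A _ w w' y) ?y1 //.
  apply: (evaluation_natural (evE A) (evE A')
            (nt_natural eps (fmap (change_of_base p1) a))) => //.
  by rewrite v0 y0 /= -comp_assoc.
exists (NatTrans (F := functor_comp (change_of_base f) Phi_f)
          (G := functor_comp Phi_p0 (change_of_base p1)) uN) => A.
apply: (mate_of_couniversal_iso (evU A) Ceff fre (k := k A)) => //.
exact: (counit_couniversal trif1 trif2 (A := A)).
Qed.

End KernelPair.

(** * Split epimorphisms as terminal maps in a fibre *)

Section SplitEpimorphism.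
Variables (C : fc_category) (X Y : C) (p : hom X Y) (s : hom Y X) (ps : p ∘ s = idm Y).

Definition split_point : Pt_fc Y := Point ps.

Definition point_over_one (T : Pt Y) : Pt (one : Pt_fc Y).
Proof.
unshelve eexists T (Pt_to_one T) (@PointHom _ _ (Pt_one Y) T (psec T) _ _).
- exact: pmap_sec.
- exact: comp_idr.
- by apply: point_hom_ext; exact: pmap_sec.
Defined.

(** Replacing an arbitrary point over the terminal object of Pt_Y by one of the form
    [point_over_one B] makes the pullbacks that define [tstar] and [pstar] have
    convertible underlying objects. *)
Lemma point_over_one_surj (B' : Pt (one : Pt_fc Y)) : exists B, B' = point_over_one B.
Proof.
case: B' => B m z mz; exists B; rewrite /point_over_one.
have mE := Pt_to_one_unique m; subst m.
set z' := @PointHom _ _ _ _ _ _ _.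
have zE : z = z'.
  by apply: point_hom_ext; rewrite /= -(ph_sec z) /= comp_idr.
subst z; congr Point; exact: proof_irrelevance.
Qed.

Lemma over_point_map (A : Pt X) : p ∘ pmap A ∘ (psec A ∘ s) = idm Y.
Proof. by rewrite -comp_assoc (whisker (pmap_sec A)) comp_idl. Qed.

(** The correspondence Pt_X C = Pt_(p, s) (Pt_Y C) on objects. *)
Definition over_point (A : Pt X) : Pt split_point.
Proof.
unshelve eexists (Point (over_point_map A) : Pt_fc Y)
  (@PointHom _ _ (Point (over_point_map A)) split_point (pmap A) _ _)
  (@PointHom _ _ split_point (Point (over_point_map A)) (psec A) _ _) => //=.
- by rewrite (whisker (pmap_sec A)) comp_idl.
- by rewrite -comp_assoc pmap_sec comp_idr.
- by apply: point_hom_ext; exact: pmap_sec.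
Defined.

Local Notation tau := (to_one split_point).
Local Notation tstar := (change_of_base tau).
Local Notation pstar := (change_of_base p).

Lemma tstar_sec (T : Pt Y) :
  ph (psec (tstar (point_over_one T))) = psec (pstar T).
Proof.
by apply: pb_ext; rewrite /= ?pb1_lift ?pb2_lift.
Qed.

Lemma tstar_dom_sec (T : Pt Y) :
  psec (pdom (tstar (point_over_one T))) = psec (pstar T) ∘ s.
Proof.
apply: pb_ext; rewrite /=.
  by rewrite pb1_lift comp_assoc pb1_lift comp_idl.
by rewrite pb2_lift comp_assoc pb2_lift -comp_assoc ps comp_idr.
Qed.

Lemma to_over_point (T : Pt Y) (A : Pt X) (k : hom (pstar T) A) :
  exists k' : hom (tstar (point_over_one T)) (over_point A), ph (ph k') = ph k.
Proof.
have m : pmap (pdom (over_point A)) ∘ ph k = pmap (pdom (tstar (point_over_one T))).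
  by rewrite /= -comp_assoc (base_map k).
have z : ph k ∘ psec (pdom (tstar (point_over_one T))) = psec (pdom (over_point A)).
  by rewrite tstar_dom_sec (whisker (ph_sec k)).
pose k1 := @PointHom C Y (pdom (tstar (point_over_one T))) (pdom (over_point A)) (ph k) m z.
unshelve eexists (@PointHom _ _ (tstar (point_over_one T)) (over_point A) k1 _ _);
  last by []; apply: point_hom_ext.
- exact: (ph_map k).
- exact: (eq_trans (f_equal (comp (ph k)) (tstar_sec T)) (ph_sec k)).
Qed.

Lemma from_over_point (T : Pt Y) (A : Pt X)
    (k' : hom (tstar (point_over_one T)) (over_point A)) :
  exists k : hom (pstar T) A, ph k = ph (ph k').
Proof.
have m : pmap A ∘ ph (ph k') = pmap (pstar T).
  exact: (f_equal (@ph _ _ _ _) (ph_map k')).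
have z : ph (ph k') ∘ psec (pstar T) = psec A.
  by rewrite -tstar_sec; exact: (f_equal (@ph _ _ _ _) (ph_sec k')).
by exists (@PointHom _ _ (pstar T) A (ph (ph k')) m z).
Qed.

Lemma tstar_fmap (T B : Pt Y) (u : hom T B)
    (u' : hom (point_over_one T) (point_over_one B)) :
  ph u' = u -> ph (ph (fmap tstar u')) = ph (fmap pstar u).
Proof. by move=> uu'; apply: pb_ext; rewrite /= ?pb1_lift ?pb2_lift //= uu'. Qed.

(** Hom-sets from [tstar] into [over_point A] and from [pstar] into A agree, so a
    couniversal arrow for the former is one for the latter. *)
Lemma split_epi_exponentiable :
  algebraically_cartesian_closed (Pt_fc Y) -> algebraically_exponentiable p.
Proof.
move=> /(_ split_point) [G [eta [eps [tri1 tri2]]]].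
apply: couniversal_right_adjoint => A.
have := counit_couniversal tri1 tri2 (A := over_point A).
have [B BE] := point_over_one_surj (G (over_point A)).
move: (eps (over_point A)); rewrite [fobj (functor_comp _ _) _]/= BE => e' e'U.
have [e eE] := from_over_point e'.
exists B, e => T k.
have e'e (u : hom T B) (u' : hom (point_over_one T) (point_over_one B)) :
    ph u' = u -> ph (ph (e' ∘ fmap tstar u')) = ph (e ∘ fmap pstar u).
  by move=> uu'; exact: (f_equal2 comp (eq_sym eE) (tstar_fmap uu')).
have [k' k'E] := to_over_point k.
have [u' [u'k u'U]] := e'U _ k'.
exists (ph u'); split.
  by apply: point_hom_ext; rewrite -(e'e _ u') // u'k k'E.
move=> u uk.
have um : pmap (point_over_one B) ∘ u = pmap (point_over_one T).
  exact: Pt_to_one_unique.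
have us : u ∘ psec (point_over_one T) = psec (point_over_one B).
  by apply: point_hom_ext; exact: (ph_sec u).
rewrite (u'U (@PointHom _ _ (point_over_one T) (point_over_one B) u um us)) //.
by apply: point_hom_ext; apply: point_hom_ext; rewrite (e'e u) // uk k'E.
Qed.

End SplitEpimorphism.

Theorem corollary3p6 :
  (forall C : fc_category, efficiently_regular C ->
   forall (X Y : C) (f : hom X Y), regular_epi f ->
   forall (R : C) (p0 p1 : hom R X), is_kernel_pair f p0 p1 ->
   algebraically_exponentiable p0 ->
   algebraically_exponentiable f /\
   forall (Phi_f : functor (Pt X) (Pt Y)) (Phi_p0 : functor (Pt R) (Pt X)),
     is_right_adjoint (change_of_base f) Phi_f ->
     is_right_adjoint (change_of_base p0) Phi_p0 ->
     naturally_isomorphic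
       (functor_comp (change_of_base f) Phi_f)
       (functor_comp Phi_p0 (change_of_base p1)))
  /\
  (forall C : fc_category, efficiently_regular C ->
   fiberwise_algebraically_cartesian_closed C ->
   forall (X Y : C) (f : hom X Y), regular_epi f ->
   algebraically_exponentiable f).
Proof.
split=> C Ceff.
  move=> X Y f fre R p0 p1 kp p0e; split.
    exact: kernel_exponentiable kp Ceff fre p0e.
  by move=> Phi_f Phi_p0; exact: kernel_beck_chevalley kp Ceff fre Phi_f Phi_p0.
move=> facc X Y f fre.
have kp := pb_is_pullback f f.
(* the diagonal splits the first projection *)
have [d [d0 _]] := pb_pair (eq_refl (f ∘ idm X)).
exact: kernel_exponentiable kp Ceff fre (split_epi_exponentiable d0 (facc X)).
Qed.
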